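(* Let $X$ be a path-connected space, $x_0\in X$, and let $p:(\widehat{X},\hat{x})\to(X,x_0)$ be a based $\mathbf{lpc}_0$-covering with $p_*(\pi_1(\widehat{X},\hat{x}))=H\subseteq\pi_1(X,x_0)$. Then there is a homeomorphism $\tilde{p}:(\widehat{X},\hat{x})\to(\widetilde{X}_H,\tilde{x}_H)$, where $\widetilde{X}_H$ has the whisker topology, such that $p_H\circ\tilde{p}=p$.
   Context: Maps are continuous functions. $\mathbf{lpc}_0$ is the category of path-connected, locally path-connected spaces. An $\mathbf{lpc}_0$-covering map is a map $p:\widehat{X}\to X$ such that $\widehat{X}$ is path-connected and locally path-connected, and for every path-connected, locally path-connected space $Y$, every $\tilde{x}\in\widehat{X}$, $y\in Y$, and every based map $f:(Y,y)\to(X,p(\tilde{x}))$ with $f_*(\pi_1(Y,y))\subseteq p_*(\pi_1(\widehat{X},\tilde{x}))$, there is a unique map $\tilde{f}:(Y,y)\to(\widehat{X},\tilde{x})$ with $p\circ\tilde{f}=f$. For a subgroup $H\subseteq\pi_1(X,x_0)$, $\widetilde{X}_H$ is the set of equivalence classes $[\alpha]_H$ of paths $\alpha:[0,1]\to X$ with $\alpha(0)=x_0$, where $\alpha\sim\beta$ iff $\alpha(1)=\beta(1)$ and $[\alpha\cdot\beta^-]\in H$ ($\beta^-$ is the reverse path and $\cdot$ is concatenation). The whisker topology on $\widetilde{X}_H$ is generated by the sets $B([\alpha]_H,U)=\{[\alpha\cdot\epsilon]_H : \epsilon \text{ a path with } \epsilon(0)=\alpha(1),\ \epsilon([0,1])\subseteq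 U\}$, where $U$ is an open neighborhood of $\alpha(1)$ in $X$. The basepoint is $\tilde{x}_H=[c_{x_0}]_H$, the class of the constant path at $x_0$, and $p_H:\widetilde{X}_H\to X$ is $p_H([\alpha]_H)=\alpha(1)$. *)

(* Defs.v *)
From HB Require Import structures.
From mathcomp Require Import all_boot all_order all_algebra.
From mathcomp Require Import generic_quotient.
From mathcomp Require Import all_classical reals topology normedtype.
From mathcomp Require Import homotopy.
From mathcomp Require Import lra.

Set Implicit Arguments.
Unset Strict Implicit.
Unset Printing Implicit Defensive.

Import Order.TTheory GRing.Theory Num.Theory.
Import numFieldNormedType.Exports.

Local Open Scope classical_set_scope.
Local Open Scope ring_scope.
Local Open Scope quotient_scope.

Section UnitInterval.
Variable R : realType.

Definition unit_itv : Type := (`[0, 1]%classic : set R).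

HB.instance Definition _ :=
  Topological.copy unit_itv (set_type (`[0, 1]%classic : set R)).

Definition itv_val (t : unit_itv) : R := \val t.

Lemma clamp_subproof (t : R) :
  Num.max 0 (Num.min 1 t) \in (`[0, 1]%classic : set R).
Proof. by rewrite inE /= in_itv /= le_max lexx ge_max ler01 ge_min lexx. Qed.

(* The retraction of the real line onto the unit interval. *)
Definition clamp (t : R) : unit_itv :=
  exist (fun x => x \in (`[0, 1]%classic : set R)) _ (clamp_subproof t).

Lemma itv_val_bound (t : unit_itv) : 0 <= itv_val t <= 1.
Proof. by have /set_mem := valP t; rewrite /= in_itv. Qed.

Lemma clampK (t : R) : 0 <= t <= 1 -> itv_val (clamp t) = t.
Proof.
by case/andP => t0 t1; rewrite /itv_val /= min_r // max_r.
Qed.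

Lemma itv_valK (t : unit_itv) : clamp (itv_val t) = t.
Proof. by apply: val_inj; exact/clampK/itv_val_bound. Qed.

Lemma clamp_le0 (t : R) : t <= 0 -> clamp t = clamp 0.
Proof.
move=> t0; apply: val_inj => /=.
by rewrite (@min_r _ _ _ t) ?(le_trans t0) // (@min_r _ _ _ 0) // !max_l.
Qed.

Lemma clamp_ge1 (t : R) : 1 <= t -> clamp t = clamp 1.
Proof. by move=> t1; apply: val_inj => /=; rewrite !min_l. Qed.

Lemma itv_val_continuous : continuous itv_val.
Proof. exact: initial_continuous. Qed.

Lemma clamp_continuous : continuous clamp.
Proof.
apply/continuous_comp_initial => t.
apply: (@max_fun_continuous _ R R (cst 0) (fun t => Num.min 1 t)) => {t} t.
  exact: cvg_cst.
by apply: (@min_fun_continuous _ R R (cst 1) id) => {}t; [exact: cvg_cst|].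
Qed.

Lemma clamp01_neq : clamp 0 != clamp 1.
Proof.
apply/eqP => /(congr1 itv_val); rewrite !clampK ?lexx ?ler01 //.
by move/eqP; rewrite eq_sym oner_eq0.
Qed.

HB.instance Definition _ :=
  @isBiPointed.Build unit_itv (clamp 0) (clamp 1) clamp01_neq.

End UnitInterval.

Section GlueAndPath.
Variables (R : realType) (X : topologicalType).
Local Notation I := (unit_itv R).

Lemma glue_continuous (T : topologicalType) (u : T -> R) (c : R)
    (f g : T -> X) :
  continuous u -> continuous f -> continuous g ->
  (forall t, u t = c -> f t = g t) ->
  continuous (fun t => if u t <= c then f t else g t).
Proof.
move=> cu cf cg fg; set h := (fun t => _).
have clA : closed [set t | u t <= c].
  by apply: (@closed_comp _ _ u [set x | x <= c]) => // ? _; exact: cu.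
have clB : closed [set t | c <= u t].
  by apply: (@closed_comp _ _ u [set x | c <= x]) => // ? _; exact: cu.
apply/continuous_subspace_setT.
rewrite (_ : setT = [set t | u t <= c] `|` [set t | c <= u t]); last first.
  apply/esym; rewrite -subTset => t _ /=.
  by case: (leP (u t) c); [left|move/ltW; right].
apply: withinU_continuous => //.
- apply: (@subspace_eq_continuous _ _ _ f); last exact: continuous_subspaceT.
  by move=> t; rewrite inE /h /from_subspace /= => ->.
- apply: (@subspace_eq_continuous _ _ _ g); last exact: continuous_subspaceT.
  move=> t; rewrite inE /h /from_subspace /= => ut; case: ifPn => // ut'.
  by rewrite fg //; apply/le_anti; rewrite ut ut'.
Qed.

Lemma affine_continuous (T : topologicalType) (u : T -> R) (a b : R) :
  continuous u -> continuous (fun t => a * u t + b).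
Proof.
move=> cu t; apply: cvgD; last exact: cvg_cst.
by apply: cvgM; [exact: cvg_cst|exact: cu].
Qed.

Lemma scale_continuous (T : topologicalType) (u : T -> R) (a : R) :
  continuous u -> continuous (fun t => a * u t).
Proof. by move=> cu t; apply: cvgM; [exact: cvg_cst|exact: cu]. Qed.

Lemma subl_continuous (T : topologicalType) (u : T -> R) (a : R) :
  continuous u -> continuous (fun t => a - u t).
Proof. by move=> cu t; apply: cvgB; [exact: cvg_cst|exact: cu]. Qed.

Lemma clamp_comp_continuous (T : topologicalType) (u : T -> R) (f : I -> X) :
  continuous f -> continuous u -> continuous (fun t => f (clamp (u t))).
Proof.
move=> cf cu t.
apply: (@continuous_comp _ _ _ u (f \o @clamp R)); first exact: cu.
by apply: continuous_comp; [exact: clamp_continuous|exact: cf].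
Qed.

Definition concat_fun (f g : I -> X) (t : I) : X :=
  if itv_val t <= 2^-1 then f (clamp (2 * itv_val t))
  else g (clamp (2 * itv_val t - 1)).

Lemma concat_fun_continuous (f g : I -> X) :
  continuous f -> continuous g -> f one = g zero ->
  continuous (concat_fun f g).
Proof.
move=> cf cg fg; apply: glue_continuous.
- exact: itv_val_continuous.
- apply: clamp_comp_continuous => //; apply: scale_continuous.
  exact: itv_val_continuous.
- apply: clamp_comp_continuous => //; apply: affine_continuous.
  exact: itv_val_continuous.
- move=> t ->; have -> : 2 * 2^-1 = 1 :> R by lra.
  by rewrite subrr; exact: fg.
Qed.

Lemma itv_val0 : itv_val (zero : I) = 0.
Proof. by rewrite clampK // lexx ler01. Qed.

Lemma itv_val1 : itv_val (one : I) = 1.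
Proof. by rewrite clampK // lexx ler01. Qed.

Section Concat.
Variables (x y z : X) (a : {path I from x to y}) (b : {path I from y to z}).

Lemma concat_continuous : continuous (concat_fun a b).
Proof.
by apply: concat_fun_continuous; [exact: cts_fun|exact: cts_fun|];
  rewrite path_one path_zero.
Qed.

Lemma concat_zero : concat_fun a b zero = x.
Proof.
by rewrite /concat_fun itv_val0 invr_ge0 ler0n mulr0; exact: path_zero.
Qed.

Lemma concat_one : concat_fun a b one = z.
Proof.
rewrite /concat_fun itv_val1 ifF; last by apply/negbTE; rewrite -ltNge; lra.
rewrite (_ : 2 * 1 - 1 = 1 :> R); last by lra.
exact: path_one.
Qed.

Definition concat : {path I from x to z} :=
  mk_path concat_continuous concat_zero concat_one.

End Concat.

Definition rev_fun (f : I -> X) (t : I) : X := f (clamp (1 - itv_val t)).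

Section Rev.
Variables (x y : X) (a : {path I from x to y}).

Lemma rev_continuous : continuous (rev_fun a).
Proof.
apply: clamp_comp_continuous; first exact: cts_fun.
by apply: subl_continuous; exact: itv_val_continuous.
Qed.

Lemma rev_zero : rev_fun a zero = y.
Proof. by rewrite /rev_fun itv_val0 subr0; exact: path_one. Qed.

Lemma rev_one : rev_fun a one = x.
Proof. by rewrite /rev_fun itv_val1 subrr; exact: path_zero. Qed.

Definition rev_path : {path I from y to x} :=
  mk_path rev_continuous rev_zero rev_one.

End Rev.

Definition cst_path (x : X) : {path I from x to x} := (cst x : I -> X).

(* Homotopy of paths relative to the endpoints; the first coordinate is the
   path parameter, the second one the time of the deformation. *)
Definition homotopic (x y : X) (a b : {path I from x to y}) : Prop :=
  exists h : I * I -> X,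
    [/\ continuous h,
        forall s, h (s, zero) = a s,
        forall s, h (s, one) = b s,
        forall t, h (zero, t) = x &
        forall t, h (one, t) = y].

Lemma homotopic_reparam (x y : X) (a b : {path I from x to y}) (F : R -> X)
    (phi psi : I -> R) :
  continuous F -> continuous phi -> continuous psi ->
  phi zero = psi zero -> phi one = psi one ->
  (forall s, a s = F (phi s)) -> (forall s, b s = F (psi s)) -> homotopic a b.
Proof.
move=> cF cphi cpsi e0 e1 aF bF.
exists (fun st => F ((1 - itv_val st.2) * phi st.1 + itv_val st.2 * psi st.1)).
have c2 : continuous (fun st : I * I => itv_val st.2).
  move=> st; apply: (@continuous_comp _ _ _ snd (@itv_val R)).
    exact: cvg_snd.
  exact: itv_val_continuous.
have c1 (u : I -> R) : continuous u -> continuous (fun st : I * I => u st.1).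
  by move=> cu st; apply: (@continuous_comp _ _ _ fst u); [exact: cvg_fst|exact: cu].
split.
- pose u (st : I * I) := (1 - itv_val st.2) * phi st.1 + itv_val st.2 * psi st.1.
  suff cu : continuous u.
    by move=> st; apply: (@continuous_comp _ R X u F); [exact: cu|exact: cF].
  move=> st; apply: cvgD; apply: cvgM.
  + exact: (subl_continuous c2).
  + exact: (c1 _ cphi).
  + exact: c2.
  + exact: (c1 _ cpsi).
- by move=> s; rewrite itv_val0 subr0 mul1r mul0r addr0 aF.
- by move=> s; rewrite itv_val1 subrr mul1r mul0r add0r bF.
- move=> t /=; rewrite -e0 -mulrDl subrK mul1r -aF; exact: path_zero.
- move=> t /=; rewrite -e1 -mulrDl subrK mul1r -aF; exact: path_one.
Qed.

Lemma clamp_path_continuous (x y : X) (a : {path I from x to y}) :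
  continuous (a \o @clamp R).
Proof.
by move=> t; apply: continuous_comp; [exact: clamp_continuous|exact: cts_fun].
Qed.

Lemma homotopic_refl (x y : X) (a : {path I from x to y}) : homotopic a a.
Proof.
by apply: (@homotopic_reparam _ _ _ _ (a \o @clamp R) (@itv_val R) (@itv_val R));
  rewrite //=; try (by move=> s; rewrite itv_valK);
  [exact: clamp_path_continuous|exact: itv_val_continuous..].
Qed.

Lemma homotopy_time_continuous (h : I * I -> X) (u : I -> R) :
  continuous h -> continuous u ->
  continuous (fun st : I * I => h (st.1, clamp (u st.2))).
Proof.
move=> ch cu st.
apply: (@continuous_comp _ _ _ (fun st : I * I => (st.1, clamp (u st.2))) h);
  last exact: ch.
apply: (@cvg_pair _ _ _ _ (nbhs st.1) (nbhs (clamp (u st.2)))).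
  exact: cvg_fst.
apply: (@continuous_comp _ _ _ snd (fun t => clamp (u t))); first exact: cvg_snd.
by apply: continuous_comp; [exact: cu|exact: clamp_continuous].
Qed.

Lemma homotopy_param_continuous (h : I * I -> X) (u : I -> R) :
  continuous h -> continuous u ->
  continuous (fun st : I * I => h (clamp (u st.1), st.2)).
Proof.
move=> ch cu st.
apply: (@continuous_comp _ _ _ (fun st : I * I => (clamp (u st.1), st.2)) h);
  last exact: ch.
apply: (@cvg_pair _ _ _ _ (nbhs (clamp (u st.1))) (nbhs st.2)); last first.
  exact: cvg_snd.
apply: (@continuous_comp _ _ _ fst (fun t => clamp (u t))); first exact: cvg_fst.
by apply: continuous_comp; [exact: cu|exact: clamp_continuous].
Qed.

Lemma clamp0E : clamp 0 = zero :> I. Proof. by []. Qed.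
Lemma clamp1E : clamp 1 = one :> I. Proof. by []. Qed.

Lemma double_continuous : continuous (fun t : I => 2 * itv_val t).
Proof. by apply: scale_continuous; exact: itv_val_continuous. Qed.

Lemma double1_continuous : continuous (fun t : I => 2 * itv_val t - 1).
Proof. by apply: affine_continuous; exact: itv_val_continuous. Qed.

Lemma subl1_continuous : continuous (fun t : I => 1 - itv_val t).
Proof. by apply: subl_continuous; exact: itv_val_continuous. Qed.

Lemma fst_val_continuous : continuous (fun st : I * I => itv_val st.1).
Proof.
move=> st; apply: (@continuous_comp _ _ _ fst (@itv_val R)).
  exact: cvg_fst.
exact: itv_val_continuous.
Qed.

Lemma snd_val_continuous : continuous (fun st : I * I => itv_val st.2).
Proof.
move=> st; apply: (@continuous_comp _ _ _ snd (@itv_val R)).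
  exact: cvg_snd.
exact: itv_val_continuous.
Qed.

Lemma halfN : (1 <= 2^-1 :> R) = false.
Proof. by apply/negbTE; rewrite -ltNge; lra. Qed.

Lemma double_half : 2 * 2^-1 = 1 :> R. Proof. by lra. Qed.

Lemma homotopic_sym (x y : X) (a b : {path I from x to y}) :
  homotopic a b -> homotopic b a.
Proof.
move=> [h [ch h0 h1 hx hy]].
exists (fun st => h (st.1, clamp (1 - itv_val st.2))); split => //=.
- exact: (homotopy_time_continuous ch subl1_continuous).
- by move=> s; rewrite itv_val0 subr0 clamp1E.
- by move=> s; rewrite itv_val1 subrr clamp0E.
Qed.

Lemma homotopic_trans (x y : X) (a b c : {path I from x to y}) :
  homotopic a b -> homotopic b c -> homotopic a c.
Proof.
move=> [h [ch h0 h1 hx hy]] [k [ck k0 k1 kx ky]].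
exists (fun st => if itv_val st.2 <= 2^-1 then h (st.1, clamp (2 * itv_val st.2))
                  else k (st.1, clamp (2 * itv_val st.2 - 1))); split => /=.
- apply: glue_continuous.
  + exact: snd_val_continuous.
  + exact: (homotopy_time_continuous ch double_continuous).
  + exact: (homotopy_time_continuous ck double1_continuous).
  + by move=> st ->; rewrite double_half subrr clamp0E clamp1E h1 k0.
- by move=> s; rewrite itv_val0 invr_ge0 ler0n mulr0 clamp0E.
- move=> s; rewrite itv_val1 halfN (_ : 2 * 1 - 1 = 1 :> R); last by lra.
  by rewrite clamp1E.
- by move=> t; case: ifP.
- by move=> t; case: ifP.
Qed.

Lemma homotopic_concat (x y z : X) (a a' : {path I from x to y})
    (b b' : {path I from y to z}) :
  homotopic a a' -> homotopic b b' -> homotopic (concat a b) (concat a' b').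
Proof.
move=> [h [ch h0 h1 hx hy]] [k [ck k0 k1 kx ky]].
exists (fun st => if itv_val st.1 <= 2^-1 then h (clamp (2 * itv_val st.1), st.2)
                  else k (clamp (2 * itv_val st.1 - 1), st.2)); split => /=.
- apply: glue_continuous.
  + exact: fst_val_continuous.
  + exact: (homotopy_param_continuous ch double_continuous).
  + exact: (homotopy_param_continuous ck double1_continuous).
  + by move=> st ->; rewrite double_half subrr clamp0E clamp1E hy kx.
- by move=> s; rewrite h0 k0.
- by move=> s; rewrite h1 k1.
- by move=> t; rewrite itv_val0 invr_ge0 ler0n mulr0 clamp0E.
- move=> t; rewrite itv_val1 halfN (_ : 2 * 1 - 1 = 1 :> R); last by lra.
  by rewrite clamp1E.
Qed.

Lemma homotopic_rev (x y : X) (a a' : {path I from x to y}) :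
  homotopic a a' -> homotopic (rev_path a) (rev_path a').
Proof.
move=> [h [ch h0 h1 hx hy]].
exists (fun st => h (clamp (1 - itv_val st.1), st.2)); split => /=.
- exact: (homotopy_param_continuous ch subl1_continuous).
- by move=> s; rewrite h0.
- by move=> s; rewrite h1.
- by move=> t; rewrite itv_val0 subr0 clamp1E.
- by move=> t; rewrite itv_val1 subrr clamp0E.
Qed.

Lemma concatE (x y z : X) (a : {path I from x to y})
    (b : {path I from y to z}) (s : I) : concat a b s = concat_fun a b s.
Proof. by []. Qed.

Lemma rev_pathE (x y : X) (a : {path I from x to y}) (s : I) :
  rev_path a s = a (clamp (1 - itv_val s)).
Proof. by []. Qed.

Lemma concatE_le (x y z : X) (a : {path I from x to y})
    (b : {path I from y to z}) (s : I) :
  itv_val s <= 2^-1 -> concat a b s = a (clamp (2 * itv_val s)).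
Proof. by move=> h; rewrite concatE /concat_fun h. Qed.

Lemma concatE_ge (x y z : X) (a : {path I from x to y})
    (b : {path I from y to z}) (s : I) :
  2^-1 <= itv_val s -> concat a b s = b (clamp (2 * itv_val s - 1)).
Proof.
move=> h; rewrite concatE /concat_fun; case: ifPn => // h'.
have -> : itv_val s = 2^-1 by apply/le_anti; rewrite h h'.
rewrite double_half subrr clamp0E clamp1E.
by rewrite (path_one (s := a)) (path_zero (s := b)).
Qed.

Lemma homotopic_concat1 (x y : X) (a : {path I from x to y}) :
  homotopic (concat (cst_path x) a) a.
Proof.
apply: (@homotopic_reparam _ _ _ _ (a \o @clamp R)
  (fun s => Num.max 0 (2 * itv_val s - 1)) (@itv_val R)).
- exact: clamp_path_continuous.
- apply: (@max_fun_continuous _ I R (cst 0)); last exact: double1_continuous.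
  exact: (@cst_continuous I R).
- exact: itv_val_continuous.
- by rewrite itv_val0 max_l //; lra.
- by rewrite itv_val1 max_r //; lra.
- move=> s; have [h|h] := leP (itv_val s) 2^-1.
    rewrite concatE_le // max_l /=; last by lra.
    by rewrite clamp0E path_zero.
  by rewrite (concatE_ge _ _ (ltW h)) max_r //; lra.
- by move=> s /=; rewrite itv_valK.
Qed.

Lemma homotopic_concatr1 (x y : X) (a : {path I from x to y}) :
  homotopic (concat a (cst_path y)) a.
Proof.
apply: (@homotopic_reparam _ _ _ _ (a \o @clamp R)
  (fun s => Num.min 1 (2 * itv_val s)) (@itv_val R)).
- exact: clamp_path_continuous.
- apply: (@min_fun_continuous _ I R (cst 1)); last exact: double_continuous.
  exact: (@cst_continuous I R).
- exact: itv_val_continuous.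
- by rewrite itv_val0 min_r //; lra.
- by rewrite itv_val1 min_l //; lra.
- move=> s; have [h|h] := leP (itv_val s) 2^-1.
    by rewrite concatE_le // min_r //; lra.
  rewrite (concatE_ge _ _ (ltW h)) min_l /=; last by lra.
  by rewrite clamp1E path_one.
- by move=> s /=; rewrite itv_valK.
Qed.

Lemma homotopic_concatV (x y : X) (a : {path I from x to y}) :
  homotopic (concat a (rev_path a)) (cst_path x).
Proof.
apply: (@homotopic_reparam _ _ _ _ (a \o @clamp R)
  (fun s => Num.min (2 * itv_val s) (1 - (2 * itv_val s - 1))) (fun=> 0)).
- exact: clamp_path_continuous.
- apply: (@min_fun_continuous _ I R); first exact: double_continuous.
  exact: (subl_continuous double1_continuous).
- exact: (@cst_continuous I R).
- by rewrite itv_val0 min_l; lra.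
- by rewrite itv_val1 min_r; lra.
- move=> s; have /andP[s0 s1] := itv_val_bound s.
  have [h|h] := leP (itv_val s) 2^-1.
    by rewrite concatE_le // min_l //; lra.
  rewrite (concatE_ge _ _ (ltW h)) min_r /=; last by lra.
  by rewrite rev_pathE clampK //; lra.
- by move=> s /=; rewrite clamp0E path_zero.
Qed.

Lemma homotopic_Vconcat (x y : X) (a : {path I from x to y}) :
  homotopic (concat (rev_path a) a) (cst_path y).
Proof.
apply: (@homotopic_reparam _ _ _ _ (a \o @clamp R)
  (fun s => Num.max (1 - 2 * itv_val s) (2 * itv_val s - 1)) (fun=> 1)).
- exact: clamp_path_continuous.
- apply: (@max_fun_continuous _ I R); last exact: double1_continuous.
  exact: (subl_continuous double_continuous).
- exact: (@cst_continuous I R).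
- by rewrite itv_val0 max_l; lra.
- by rewrite itv_val1 max_r; lra.
- move=> s; have /andP[s0 s1] := itv_val_bound s.
  have [h|h] := leP (itv_val s) 2^-1.
    rewrite concatE_le // max_l /=; last by lra.
    by rewrite rev_pathE clampK //; lra.
  by rewrite (concatE_ge _ _ (ltW h)) max_r //; lra.
- by move=> s /=; rewrite clamp1E path_one.
Qed.

Lemma homotopic_concatA (x y z w : X) (a : {path I from x to y})
    (b : {path I from y to z}) (c : {path I from z to w}) :
  homotopic (concat a (concat b c)) (concat (concat a b) c).
Proof.
pose F (t : R) := if t <= 1 then a (clamp t)
  else if t <= 2 then b (clamp (t - 1)) else c (clamp (t - 2)).
have idc : continuous (@id R) by move=> t; exact: cvg_id.
have subc (r : R) : continuous (fun t : R => t - r).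
  by move=> t; apply: cvgB; [exact: cvg_id|exact: cvg_cst].
apply: (@homotopic_reparam _ _ _ _ F
  (fun s => Num.max (2 * itv_val s) (4 * itv_val s - 1))
  (fun s => Num.min (4 * itv_val s) (2 * itv_val s + 1))).
- apply: (glue_continuous idc).
  + exact: clamp_path_continuous.
  + apply: (glue_continuous idc).
    * apply: clamp_comp_continuous; first exact: cts_fun.
      exact: subc.
    * apply: clamp_comp_continuous; first exact: cts_fun.
      exact: subc.
    * move=> t /= ->; rewrite subrr (_ : 2 - 1 = 1 :> R); last by lra.
      by rewrite clamp1E clamp0E path_one path_zero.
  + move=> t /= ->; rewrite ler1n /= subrr clamp1E clamp0E.
    by rewrite path_one path_zero.
- apply: (@max_fun_continuous _ I R); first exact: double_continuous.
  by apply: affine_continuous; exact: itv_val_continuous.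
- apply: (@min_fun_continuous _ I R).
    by apply: scale_continuous; exact: itv_val_continuous.
  by apply: affine_continuous; exact: itv_val_continuous.
- by rewrite itv_val0 max_l ?min_l; lra.
- by rewrite itv_val1 max_r ?min_r; lra.
- move=> s; have /andP[s0 s1] := itv_val_bound s; rewrite /F.
  have [h|h] := leP (itv_val s) 2^-1.
    rewrite concatE_le // max_l; last by lra.
    by rewrite ifT //; lra.
  rewrite (concatE_ge _ _ (ltW h)) max_r; last by lra.
  rewrite ifF; last by apply/negbTE; rewrite -ltNge; lra.
  have bd : 0 <= 2 * itv_val s - 1 <= 1 by lra.
  have [h'|h'] := leP (4 * itv_val s - 1) 2.
    rewrite concatE_le clampK //; last by lra.
    by congr (b (clamp _)); lra.
  rewrite concatE_ge clampK //; last by lra.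
  by congr (c (clamp _)); lra.
- move=> s; have /andP[s0 s1] := itv_val_bound s; rewrite /F.
  have [h|h] := leP (itv_val s) 2^-1.
    have bd : 0 <= 2 * itv_val s <= 1 by lra.
    rewrite concatE_le // min_l; last by lra.
    have [h'|h'] := leP (4 * itv_val s) 1.
      rewrite concatE_le clampK //; last by lra.
      by congr (a (clamp _)); lra.
    rewrite concatE_ge clampK //; last by lra.
    rewrite ifT; last by lra.
    by congr (b (clamp _)); lra.
  rewrite (concatE_ge _ _ (ltW h)) min_r; last by lra.
  rewrite ifF; last by apply/negbTE; rewrite -ltNge; lra.
  rewrite ifF; last by apply/negbTE; rewrite -ltNge; lra.
  by congr (c (clamp _)); lra.
Qed.

End GlueAndPath.

Section FundamentalGroup.
Variables (R : realType) (X : topologicalType) (x0 : X).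
Local Notation I := (unit_itv R).

Definition loop : choiceType := {path I from x0 to x0}.

Definition homotopicb (a b : loop) : bool := `[< homotopic a b >].

Lemma homotopicb_refl : reflexive homotopicb.
Proof. by move=> a; apply/asboolP/homotopic_refl. Qed.

Lemma homotopicb_sym : symmetric homotopicb.
Proof.
by move=> a b; apply/asboolP/asboolP => /homotopic_sym.
Qed.

Lemma homotopicb_trans : transitive homotopicb.
Proof.
by move=> b a c /asboolP ab /asboolP bc; apply/asboolP/(homotopic_trans ab bc).
Qed.

Canonical homotopic_equiv :=
  EquivRel homotopicb homotopicb_refl homotopicb_sym homotopicb_trans.

Definition pi1 : Type := {eq_quot homotopic_equiv}.

HB.instance Definition _ := Choice.on pi1.
HB.instance Definition _ := EqQuotient.on pi1.

Definition loop_class (a : loop) : pi1 := \pi_pi1 a.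

Lemma loop_classP (a b : loop) : loop_class a = loop_class b <-> homotopic a b.
Proof. by split => [/eqmodP/asboolP|/asboolP h]; last exact/eqmodP. Qed.

Lemma loop_classW (P : pi1 -> Prop) :
  (forall a, P (loop_class a)) -> forall p, P p.
Proof. by move=> h p; rewrite -[p]reprK; exact: h. Qed.

Definition pi1_one : pi1 := loop_class (cst_path R x0).
Definition pi1_mul (p q : pi1) : pi1 := loop_class (concat (repr p) (repr q)).
Definition pi1_inv (p : pi1) : pi1 := loop_class (rev_path (repr p)).

Lemma homotopic_repr (a : loop) : homotopic (repr (loop_class a)) a.
Proof. by apply/loop_classP; rewrite /loop_class reprK. Qed.

Lemma pi1_mulE (a b : loop) :
  pi1_mul (loop_class a) (loop_class b) = loop_class (concat a b).
Proof. by apply/loop_classP/homotopic_concat; exact: homotopic_repr. Qed.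

Lemma pi1_invE (a : loop) : pi1_inv (loop_class a) = loop_class (rev_path a).
Proof. by apply/loop_classP/homotopic_rev; exact: homotopic_repr. Qed.

Lemma pi1_mulA : associative pi1_mul.
Proof.
elim/loop_classW => a; elim/loop_classW => b; elim/loop_classW => c.
by rewrite !pi1_mulE; apply/loop_classP/homotopic_concatA.
Qed.

Lemma pi1_mul1 : left_id pi1_one pi1_mul.
Proof.
by elim/loop_classW => a; rewrite pi1_mulE; apply/loop_classP/homotopic_concat1.
Qed.

Lemma pi1_mulr1 : right_id pi1_one pi1_mul.
Proof.
elim/loop_classW => a; rewrite pi1_mulE.
exact/loop_classP/homotopic_concatr1.
Qed.

Lemma pi1_mulV : left_inverse pi1_one pi1_inv pi1_mul.
Proof.
elim/loop_classW => a; rewrite pi1_invE pi1_mulE.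
exact/loop_classP/homotopic_Vconcat.
Qed.

Lemma pi1_mulrV : right_inverse pi1_one pi1_inv pi1_mul.
Proof.
elim/loop_classW => a; rewrite pi1_invE pi1_mulE.
exact/loop_classP/homotopic_concatV.
Qed.

HB.instance Definition _ := isGroup.Build pi1
  pi1_mulA pi1_mul1 pi1_mulr1 pi1_mulV pi1_mulrV.

End FundamentalGroup.

Section InducedMap.
Variables (R : realType) (X Y : topologicalType) (f : X -> Y).
Hypothesis cf : continuous f.
Local Notation I := (unit_itv R).

Section MapPath.
Variables (x x' : X) (y y' : Y) (fx : f x = y) (fx' : f x' = y').
Variable a : {path I from x to x'}.

Lemma map_path_continuous : continuous (f \o a).
Proof.
by move=> t; apply: continuous_comp; [exact: cts_fun|exact: cf].
Qed.

Lemma map_path_zero : (f \o a) zero = y.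
Proof. by rewrite /= path_zero. Qed.

Lemma map_path_one : (f \o a) one = y'.
Proof. by rewrite /= path_one. Qed.

Definition map_path : {path I from y to y'} :=
  mk_path map_path_continuous map_path_zero map_path_one.

End MapPath.

Lemma homotopic_map (x x' : X) (y y' : Y) (fx : f x = y) (fx' : f x' = y')
    (a b : {path I from x to x'}) :
  homotopic a b -> homotopic (map_path fx fx' a) (map_path fx fx' b).
Proof.
move=> [h [ch h0 h1 hx hx']]; exists (f \o h); split => /=.
- by move=> st; apply: continuous_comp; [exact: ch|exact: cf].
- by move=> s; rewrite h0.
- by move=> s; rewrite h1.
- by move=> t; rewrite hx.
- by move=> t; rewrite hx'.
Qed.

(* The homomorphism of fundamental groups induced by the based map
   f : (X, x) -> (Y, y). *)
Definition pi1_map (x : X) (y : Y) (fx : f x = y) (p : pi1 R x) : pi1 R y :=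
  loop_class (map_path fx fx (repr p)).

Lemma pi1_mapE (x : X) (y : Y) (fx : f x = y) (a : loop R x) :
  pi1_map fx (loop_class a) = loop_class (map_path fx fx a).
Proof. by apply/loop_classP/homotopic_map/homotopic_repr. Qed.

End InducedMap.

Arguments pi1_map R {X Y f} cf {x y} fx p.

Section PathConnected.
Variables (R : realType) (X : topologicalType).

(* A is path-connected in the subspace topology; connectedness of the whole
   space is path_connected [set: X]. *)
Definition path_connected (A : set X) : Prop :=
  forall x y : X, A x -> A y ->
    exists a : {path (unit_itv R) from x to y}, range a `<=` A.

Definition locally_path_connected : Prop :=
  forall (x : X) (U : set X), nbhs x U ->
    exists V : set X, [/\ open V, V x, V `<=` U & path_connected V].

End PathConnected.

Definition lpc0_covering (R : realType) (E X : topologicalType) (p : E -> X)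
    (cp : continuous p) : Prop :=
  [/\ path_connected R [set: E], locally_path_connected R E &
    forall Y : topologicalType,
      path_connected R [set: Y] -> locally_path_connected R Y ->
    forall (e : E) (y : Y) (f : Y -> X) (cf : continuous f) (fy : f y = p e),
      range (pi1_map R cf fy) `<=` range (pi1_map R cp (erefl (p e))) ->
      exists! g : Y -> E, [/\ continuous g, g y = e & p \o g = f]].

Section WhiskerSpace.
Variables (R : realType) (X : topologicalType) (x0 : X).
Variable H : groupClosed (pi1 R x0).
Local Notation I := (unit_itv R).

(* Paths starting at x0, tagged with their endpoint. *)
Definition based_path : Type := {y : X & {path I from x0 to y}}.

HB.instance Definition _ := Choice.on based_path.

(* a ~ b iff a and b have the same endpoint y and [a . b^-] belongs to H;
   the common endpoint is enforced by the index y. *)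
Inductive coset_rel : based_path -> based_path -> Prop :=
  CosetRel (y : X) (a b : {path I from x0 to y}) of
    loop_class (concat a (rev_path b)) \in H :
    coset_rel (existT _ y a) (existT _ y b).

Lemma coset_rel_tag (a b : based_path) : coset_rel a b -> tag a = tag b.
Proof. by case. Qed.

Definition coset_relb (a b : based_path) : bool := `[< coset_rel a b >].

Lemma coset_relP (y : X) (a b : {path I from x0 to y}) :
  coset_rel (existT _ y a) (existT _ y b) <->
  loop_class (concat a (rev_path b)) \in H.
Proof.
split; last exact: CosetRel.
move E1 : (existT _ y a) => a'; move E2 : (existT _ y b) => b' r.
case: r E1 E2 => z c d h E1 E2; move: E1 E2 h.
move=> /esym E1; have ez : z = y by case: E1.
case: _ / (esym ez) in c d E1 * => /esym E2.
by rewrite (existT_inj2 E1) (existT_inj2 E2).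
Qed.

Lemma pi1_cancel (y : X) (a b c : {path I from x0 to y}) :
  (loop_class (concat a (rev_path b)) * loop_class (concat b (rev_path c)))%g =
  loop_class (concat a (rev_path c)).
Proof.
rewrite [LHS]pi1_mulE; apply/loop_classP.
apply: (homotopic_trans (homotopic_sym (homotopic_concatA _ _ _))).
apply: homotopic_concat; first exact: homotopic_refl.
apply: (homotopic_trans (homotopic_concatA _ _ _)).
apply: homotopic_trans (homotopic_concat1 _).
apply: homotopic_concat; last exact: homotopic_refl.
exact: homotopic_Vconcat.
Qed.

Lemma coset_relb_refl : reflexive coset_relb.
Proof.
move=> [y a]; apply/asboolP/CosetRel.
have /loop_classP -> := homotopic_concatV a.
exact: (@gpred1 _ H : pi1_one R x0 \in H).
Qed.

Lemma coset_relb_sym : symmetric coset_relb.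
Proof.
suff h a b : coset_rel a b -> coset_rel b a.
  by move=> a b; apply/asboolP/asboolP; exact: h.
case=> y {}a {}b abH; apply: CosetRel.
suff -> : loop_class (concat b (rev_path a)) =
    ((loop_class (concat a (rev_path b)))^-1)%g by rewrite gpredVr.
rewrite -[LHS](mulKg (loop_class (concat a (rev_path b)))) pi1_cancel.
have /loop_classP -> := homotopic_concatV a.
exact: mulg1.
Qed.

Lemma coset_relb_trans : transitive coset_relb.
Proof.
move=> b' a' c' /asboolP ab /asboolP bc; apply/asboolP.
case: ab bc => y a b abH; case: c' => z c bc.
have ez : y = z := coset_rel_tag bc.
case: z / ez c bc => c bc; apply: CosetRel.
by rewrite -(pi1_cancel a b c) gpredM //; exact/coset_relP.
Qed.

Canonical coset_equiv :=
  EquivRel coset_relb coset_relb_refl coset_relb_sym coset_relb_trans.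

Definition whisker_space : Type := {eq_quot coset_equiv}.

HB.instance Definition _ := Choice.on whisker_space.
HB.instance Definition _ := EqQuotient.on whisker_space.

Definition whisker_class (y : X) (a : {path I from x0 to y}) : whisker_space :=
  \pi_whisker_space (existT _ y a).

(* B([a], U); as a set it depends only on the class of a when H is a subgroup,
   so it is indexed by the representative a. *)
Definition whisker_nbhd (y : X) (a : {path I from x0 to y}) (U : set X) :
    set whisker_space :=
  [set z | exists (y' : X) (e : {path I from y to y'}),
      range e `<=` U /\ z = whisker_class (concat a e)].

(* The whisker topology, generated by the sets B([a], U). *)
HB.instance Definition _ := @isSubBaseTopological.Build whisker_space
  (set whisker_space)
  [set B | exists (y : X) (a : {path I from x0 to y}) (U : set X),
      [/\ open U, U y & B = whisker_nbhd a U]]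
  idfun.

Definition whisker_base : whisker_space := whisker_class (cst_path R x0).

Definition whisker_proj (z : whisker_space) : X := tag (repr z).

Lemma whisker_classP (y : X) (a b : {path I from x0 to y}) :
  whisker_class a = whisker_class b <->
  loop_class (concat a (rev_path b)) \in H.
Proof.
rewrite -coset_relP; split => [/eqmodP/asboolP//|h].
by apply/eqmodP/asboolP.
Qed.

Lemma whisker_projE (y : X) (a : {path I from x0 to y}) :
  whisker_proj (whisker_class a) = y.
Proof.
rewrite /whisker_proj.
by have /eqmodP/asboolP/coset_rel_tag := reprK (whisker_class a).
Qed.

End WhiskerSpace.

Arguments whisker_class {R X x0} H {y} a.
Arguments whisker_nbhd {R X x0} H {y} a U.
Arguments whisker_proj {R X x0} H z.

Definition homeomorphism (S T : topologicalType) (f : S -> T) : Prop :=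
  continuous f /\
  exists g : T -> S, [/\ continuous g, cancel f g & cancel g f].

(* Main.v *)
(* The homeomorphism sends e to the class of p o g for any path g from e0 to
   e. Since R and R * R are path-connected, locally path-connected and
   contractible, the lifting property gives unique path lifting and homotopy
   lifting, hence bijectivity; local path-connectedness of E gives
   continuity. Openness is the delicate point, because p_H is not known to
   lift loops uniquely. It amounts to finding, for each neighborhood V of e,
   a neighborhood U of p e all of whose paths issued from p e have lifts at e
   ending in V. For this, glue all the paths issued from p e at their origin,
   with a topology in which every neighborhood U of p e yields a neighborhood
   of the wedge point made of the initial segments that stay in U. This wedge
   is contractible and locally path-connected, so its evaluation map lifts to
   E, and continuity of the lift at the wedge point yields U from V. *)
Require Import Defs.
From HB Require Import structures.
From mathcomp Require Import all_boot all_order all_algebra.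
From mathcomp Require Import finmap.
From mathcomp Require Import all_classical reals topology normedtype.
From mathcomp Require Import homotopy.
From mathcomp Require Import lra.

Set Implicit Arguments.
Unset Strict Implicit.
Unset Printing Implicit Defensive.

Import Order.TTheory GRing.Theory Num.Theory.
Import numFieldNormedType.Exports.

Local Open Scope classical_set_scope.
Local Open Scope ring_scope.

(** * Continuity of pairings and composites *)

Lemma pair_continuous (S T U : topologicalType) (f : S -> T) (g : S -> U) :
  continuous f -> continuous g -> continuous (fun s => (f s, g s)).
Proof.
move=> cf cg s; apply: (@cvg_pair _ _ _ _ (nbhs (f s)) (nbhs (g s))).
  exact: cf.
exact: cg.
Qed.

Lemma comp_continuous (S T U : topologicalType) (f : S -> T) (g : T -> U) :
  continuous f -> continuous g -> continuous (g \o f).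
Proof. by move=> cf cg s; apply: continuous_comp; [exact: cf|exact: cg]. Qed.

(** * Path-connectedness of normed modules, globally and locally *)

Section NormedModule.
Variables (R : realType) (V : normedModType R).
Local Notation I := (unit_itv R).

Lemma segment_continuous (u v : V) :
  continuous (fun t : I => u + itv_val t *: (v - u)).
Proof.
apply: (@comp_continuous _ R V (@itv_val R) (fun r => u + r *: (v - u))).
  exact: itv_val_continuous.
move=> r; apply: cvgD; first exact: cvg_cst.
by apply: cvgZr_tmp; exact: cvg_id.
Qed.

(** Balls are convex: along a segment, the distance to the center is at most the larger of its
    values at the two ends. *)
Lemma ball_path_connected (c : V) (r : R) : path_connected R (ball c r).
Proof.
move=> u v cu cv.
have u0 : u + itv_val (zero : I) *: (v - u) = u.
  by rewrite itv_val0 scale0r addr0.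
have v1 : u + itv_val (one : I) *: (v - u) = v.
  by rewrite itv_val1 scale1r addrC subrK.
exists (mk_path (@segment_continuous u v) u0 v1) => _ [t _ <-] /=.
have /andP[t0 t1] := itv_val_bound t.
move: cu cv; rewrite /mk_path -!ball_normE /= => cu cv.
rewrite (_ : c - _ = (1 - itv_val t) *: (c - u) +
    itv_val t *: (c - v)); last first.
  rewrite scalerBl scale1r -addrA [in RHS](addrC (- _)) -scalerBr.
  rewrite (_ : c - v - (c - u) = u - v); last by rewrite opprB addrC subrKA.
  by rewrite opprD addrA -scalerN opprB.
apply: (le_lt_trans (ler_normD _ _)); rewrite !normrZ ger0_norm ?subr_ge0 //.
rewrite (ger0_norm t0).
have /le_lt_trans : (1 - itv_val t) * `|c - u| + itv_val t * `|c - v| <=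
    Num.max `|c - u| `|c - v|.
  set m := Num.max _ _.
  have um : `|c - u| <= m by rewrite le_max lexx.
  have vm : `|c - v| <= m by rewrite le_max lexx orbT.
  by nra.
by apply; rewrite gt_max cu.
Qed.

Lemma normed_locally_path_connected : locally_path_connected R V.
Proof.
move=> x U /nbhs_ballP[r r0 xU]; exists (ball x r); split => //.
- exact: ball_open.
- exact: ballxx.
- exact: ball_path_connected.
Qed.

Lemma normed_path_connected : path_connected R [set: V].
Proof.
move=> u v _ _.
(* This ball around the origin is large enough to contain both points. *)
have := @ball_path_connected 0 (`|u| + `|v| + 1) u v.
rewrite -ball_normE /= !sub0r !normrN; have := normr_ge0 u; have := normr_ge0 v.
by move=> v0 u0 []; [lra|lra|move=> a _; exists a].
Qed.

End NormedModule.

Lemma itv_val_snd_continuous (R : realType) (T : topologicalType) :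
  continuous (fun zt : T * unit_itv R => itv_val zt.2).
Proof.
apply: (@comp_continuous _ _ _ snd (@itv_val R)).
  by move=> ?; exact: cvg_snd.
exact: itv_val_continuous.
Qed.

(** * Lifting of nullhomotopic maps, paths and homotopies *)

Section Lifting.
Variables (R : realType) (E X : topologicalType) (p : E -> X).
Hypothesis cp : continuous p.
Hypothesis lift_p : lpc0_covering R cp.
Local Notation I := (unit_itv R).

(** Since [K] fixes the image of [y], it deforms the image under [f] of any loop at [y] into the
    constant loop. The image of [f] on fundamental groups is thus trivial, and the lifting criterion
    applies. *)
Lemma lift_nullhomotopic (Y : topologicalType) (K : Y * I -> X) (f : Y -> X)
    (e : E) (y : Y) :
  path_connected R [set: Y] -> locally_path_connected R Y ->
  continuous K ->
  (forall z, K (z, one) = f z) -> (forall z, K (z, zero) = p e) ->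
  (forall t, K (y, t) = p e) ->
  exists! g : Y -> E, [/\ continuous g, g y = e & p \o g = f].
Proof.
move=> Yc Yl cK K1 K0 Ky; have [_ _] := lift_p.
have cf : continuous f.
  rewrite (_ : f = K \o (fun z => (z, one))); last by apply/funext => z /=.
  apply: comp_continuous => //; apply: pair_continuous => // z.
    exact: cvg_id.
  exact: cvg_cst.
have fy : f y = p e by rewrite -K1.
move/(_ Y Yc Yl e y f cf fy); apply => _ [q _ <-].
exists (pi1_one R e) => //.
rewrite /pi1_one pi1_mapE; apply/loop_classP.
exists (fun st => K (repr q st.1, st.2)); split.
- apply: comp_continuous => //.
  apply: pair_continuous; last by move=> ?; exact: cvg_snd.
  apply: (@comp_continuous _ _ _ fst (repr q)); last exact: cts_fun.
  by move=> ?; exact: cvg_fst.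
- by move=> s; rewrite K0.
- by move=> s; rewrite K1.
- by move=> t; rewrite path_zero.
- by move=> t; rewrite path_one.
Qed.

Lemma lift_normed (V : normedModType R) (f : V -> X) (e : E) :
  continuous f -> f 0 = p e ->
  exists! g : V -> E, [/\ continuous g, g 0 = e & p \o g = f].
Proof.
move=> cf f0.
(* The homotopy is radial contraction to the origin, followed by [f]. *)
apply: (@lift_nullhomotopic V (fun zt => f (itv_val zt.2 *: zt.1))).
- exact: normed_path_connected.
- exact: normed_locally_path_connected.
- apply: (@comp_continuous _ _ _
    (fun zt : V * I => itv_val zt.2 *: zt.1)) => //.
  apply: (@comp_continuous _ (V * R)%type V
    (fun zt : V * I => (zt.1, itv_val zt.2)) (fun zr => zr.2 *: zr.1)).
    apply: pair_continuous; first by move=> ?; exact: cvg_fst.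
    exact: itv_val_snd_continuous.
  by move=> zr; apply: cvgZ; [exact: cvg_snd|exact: cvg_fst].
- by move=> z; rewrite itv_val1 scale1r.
- by move=> z; rewrite itv_val0 scale0r.
- by move=> t; rewrite scaler0.
Qed.

(** Precomposing with [clamp] extends the path to the real line, where [lift_normed] applies; the
    lift is then restricted to the interval. *)
Lemma lift_path (e : E) (x : X) (f : {path I from p e to x}) :
  exists (e' : E) (g : {path I from e to e'}), p e' = x /\ p \o g = f.
Proof.
have [||g [[cg g0 pg] _]] := @lift_normed R^o (f \o @clamp R) e.
- exact: clamp_path_continuous.
- by rewrite /= clamp0E path_zero.
pose h (t : I) := g (itv_val t).
have ch : continuous h.
  by apply: comp_continuous => //; exact: itv_val_continuous.
have ph : p \o h = f.
  by apply/funext => t; rewrite /= /h -[LHS]/((p \o g) _) pg /= itv_valK.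
have h0 : h zero = e by rewrite /h itv_val0.
exists (h one), (mk_path ch h0 erefl); split => //.
by rewrite -[LHS]/((p \o h) _) ph path_one.
Qed.

(** Extended by [clamp], both paths lift the same map on the line with the same value at 0. *)
Lemma lift_path_unique (g h : I -> E) :
  continuous g -> continuous h -> g zero = h zero -> p \o g = p \o h -> g = h.
Proof.
move=> cg ch gh0 pgh.
have [||k [_ kU]] := @lift_normed R^o (p \o g \o @clamp R) (g zero).
- apply: comp_continuous; first exact: clamp_continuous.
  exact: comp_continuous.
- by rewrite /= clamp0E.
have clampl (u : I -> E) : continuous u -> continuous (u \o @clamp R).
  by apply: comp_continuous; exact: clamp_continuous.
have kg : k = g \o @clamp R by apply: kU; split => //; exact: clampl.
have kh : k = h \o @clamp R.
  by apply: kU; rewrite pgh gh0; split => //; exact: clampl.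
apply/funext => t; rewrite -(itv_valK t) -[LHS]/((g \o @clamp R) _).
by rewrite -kg kh.
Qed.

(** The homotopy, extended to the plane by [clamp], lifts to [l]. Uniqueness of path lifting
    identifies [l] on the four sides of the square: [g], [h] and two constant paths. Reading the
    corner (1, 1) along two sides gives the equality. *)
Lemma monodromy (e e1 e2 : E) (x : X) (a b : {path I from p e to x})
    (g : {path I from e to e1}) (h : {path I from e to e2}) :
  homotopic a b -> p \o g = a -> p \o h = b -> e1 = e2.
Proof.
move=> [k [ck k0 k1 kx ky]] ga hb.
have c_ (f : R^o * R^o -> R^o) : continuous f ->
    continuous (@clamp R \o f).
  by move=> cf; apply: comp_continuous => //; exact: clamp_continuous.
have [||l [[cl l0 pl] _]] := @lift_normed (R^o * R^o)%type
    (fun st => k (clamp st.1, clamp st.2)) e.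
- apply: (@comp_continuous _ _ _
    (fun st : R * R => (clamp st.1, clamp st.2))) => //.
  apply: pair_continuous; apply: c_.
    by move=> ?; exact: cvg_fst.
  by move=> ?; exact: cvg_snd.
- by rewrite /= clamp0E kx.
have {}pl s t : p (l (itv_val s, itv_val t)) = k (s, t).
  by rewrite -[LHS]/((p \o l) _) pl /= !itv_valK.
have cl1 t : continuous (fun s : I => l (itv_val s, itv_val t)).
  apply: (@comp_continuous _ _ _
    (fun s : I => (itv_val s, itv_val t) : R^o * R^o)) => //.
  apply: pair_continuous; first exact: itv_val_continuous.
  exact: (@cst_continuous I R^o).
have cl2 s : continuous (fun t : I => l (itv_val s, itv_val t)).
  apply: (@comp_continuous _ _ _
    (fun t : I => (itv_val s, itv_val t) : R^o * R^o)) => //.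
  apply: pair_continuous; last exact: itv_val_continuous.
  exact: (@cst_continuous I R^o).
have l00 : l (itv_val (zero : I), itv_val (zero : I)) = e by rewrite itv_val0.
have cc (c : E) : continuous (cst c : I -> E) by exact: cst_continuous.
have L0 : (fun s : I => l (itv_val s, itv_val (zero : I))) = g.
  apply: lift_path_unique => //; first exact: cts_fun.
    by rewrite l00 path_zero.
  by rewrite ga; apply/funext => s /=; rewrite pl k0.
have R0 : (fun t : I => l (itv_val (zero : I), itv_val t)) = cst e.
  apply: lift_path_unique => //.
  by apply/funext => s /=; rewrite pl kx.
have R1 : (fun t : I => l (itv_val (one : I), itv_val t)) = cst e1.
  have lg1 : l (itv_val (one : I), itv_val (zero : I)) = e1.
    rewrite -[LHS]/((fun s : I => l (itv_val s, itv_val (zero : I))) one).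
    by rewrite L0 path_one.
  apply: lift_path_unique => //.
  by apply/funext => s /=; rewrite pl ky -lg1 pl ky.
have L1 : (fun s : I => l (itv_val s, itv_val (one : I))) = h.
  apply: lift_path_unique => //; first exact: cts_fun.
    rewrite path_zero.
    rewrite -[LHS]/((fun t : I => l (itv_val (zero : I), itv_val t)) one).
    by rewrite R0.
  by rewrite hb; apply/funext => s /=; rewrite pl k1.
rewrite -(path_one (s := h)) -[X in _ = X]/((h : I -> E) one) -L1.
by rewrite -[RHS]/((fun t : I => l (itv_val (one : I), itv_val t)) one) R1.
Qed.

End Lifting.

(** * Ranges of concatenated and mapped paths *)

Section PathRange.
Variables (R : realType) (X : topologicalType).
Local Notation I := (unit_itv R).

Lemma concat_range (x y z : X) (a : {path I from x to y})
    (b : {path I from y to z}) (A : set X) :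
  range a `<=` A -> range b `<=` A -> range (concat a b) `<=` A.
Proof.
move=> aA bA _ [t _ <-]; rewrite concatE /concat_fun.
by case: ifP => _; [apply: aA|apply: bA]; eexists.
Qed.

Lemma map_path_range (Y : topologicalType) (f : X -> Y) (cf : continuous f)
    (x x' : X) (y y' : Y) (fx : f x = y) (fx' : f x' = y')
    (a : {path I from x to x'}) (A : set Y) :
  range a `<=` f @^-1` A -> range (Defs.map_path cf fx fx' a) `<=` A.
Proof. by move=> aA _ [t _ <-]; apply: aA; exists t. Qed.

End PathRange.

(** * The wedge of all paths issued from a point *)

Section Fan.
Variables (R : realType) (X : topologicalType) (x : X).
Local Notation I := (unit_itv R).

Definition arc : Type :=
  {c : R -> X | continuous c /\ forall t, t <= 0 -> c t = x}.

(* Wedge of all the paths issued from x; the wedge point is represented by all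
   the pairs (c, t) with t <= 0, which saves a quotient. A point (c, t) with
   t > 0 has small intervals of the arc c as neighborhoods. *)
Definition fan : Type := (arc * R)%type.

Definition fan_eval (z : fan) : X := sval z.1 z.2.

(** Quantifying over all [s] up to [z.2] makes a sector stable under moving back along an arc. *)
Definition sector (U : set X) : set fan :=
  [set z | forall s, s <= z.2 -> U (fan_eval (z.1, s))].

(** The second clause asks for a single [U] valid for all arcs at once; this uniformity is what
    [lift_small] extracts. *)
Definition fan_open : set (set fan) :=
  [set O | (forall c, open [set t : R | O (c, t)]) /\
     forall c t, t <= 0 -> O (c, t) ->
       exists U, [/\ open U, U x & sector U `<=` O]].

Lemma fan_openT : fan_open setT.
Proof.
split=> [c|c t _ _]; last by exists setT; split => //; exact: openT.
by rewrite (_ : [set t | _] = setT) //; exact: openT.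
Qed.

Lemma fan_openI : setI_closed fan_open.
Proof.
move=> A B [oA bA] [oB bB]; split=> [c|c t t0 [At Bt]].
  exact: (openI (oA c) (oB c)).
have [U [oU Ux UA]] := bA c t t0 At; have [V [oV Vx VB]] := bB c t t0 Bt.
exists (U `&` V); split=> //; first exact: openI.
by move=> z UVz; split; [apply: UA => s /UVz[]|apply: VB => s /UVz[]].
Qed.

Lemma fan_open_bigU (J : Type) (f : J -> set fan) :
  (forall j, fan_open (f j)) -> fan_open (\bigcup_j f j).
Proof.
move=> of_; split=> [c|c t t0 [j _ fjt]].
  rewrite (_ : [set t | _] = \bigcup_j [set t | f j (c, t)]) //.
  by apply: bigcup_open => j _; have [] := of_ j.
have [_ /(_ c t t0 fjt)[U [oU Ux UA]]] := of_ j.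
by exists U; split=> // z /UA fjz; exists j.
Qed.

HB.instance Definition _ := gen_eqMixin fan.
HB.instance Definition _ := gen_choiceMixin fan.
HB.instance Definition _ := isOpenTopological.Build fan
  fan_openT fan_openI fan_open_bigU.

Lemma fan_openE : open = fan_open. Proof. by []. Qed.

Lemma arc_continuous (c : arc) : continuous (sval c).
Proof. by case: c => c []. Qed.

Lemma fan_eval_le0 (c : arc) (t : R) : t <= 0 -> fan_eval (c, t) = x.
Proof. by case: c => c [cc c0] /c0. Qed.

(** If [(c, t)] is in the sector, a parameter close to [t] only adds values of [c] near [c t], which
    stay in [U] by continuity. *)
Lemma sector_open (U : set X) : open U -> open (sector U).
Proof.
move=> oU; rewrite fan_openE; split=> [c|c t t0 /(_ t (lexx _))]; last first.
  by rewrite /= fan_eval_le0 // => Ux; exists U; split=> // ?.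
rewrite openE => t /= Ut.
have /nbhs_ballP[r r0 tU] : nbhs t (sval c @^-1` U).
  by apply: arc_continuous; apply: open_nbhs_nbhs; split=> //; exact: Ut.
apply/nbhs_ballP; exists r => //= t' tt' s; rewrite /= => st'.
have [/Ut//|ts] := leP s t.
apply: tU; move: tt'; rewrite -!ball_normE /= !ltr_norml; lra.
Qed.

Lemma sector_le0 (U : set X) (c : arc) (t : R) :
  U x -> t <= 0 -> sector U (c, t).
Proof. by move=> Ux t0 s /= st; rewrite fan_eval_le0 // (le_trans st). Qed.

Lemma arc_inclusion_continuous (c : arc) :
  continuous (fun t : R => (c, t) : fan).
Proof.
by apply/continuousP => A; rewrite fan_openE => -[oA _]; exact: oA.
Qed.

(* The points (c, t) with t <= 0 are topologically indistinguishable, so a map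
   into them is continuous whatever its values. *)
Lemma fan_center_continuous (T : topologicalType) (f : T -> fan) :
  (forall t, (f t).2 <= 0) -> continuous f.
Proof.
move=> f0; apply/continuousP => A; rewrite fan_openE => -[_ cA].
have [[t At]|nA] := pselect (exists t, A (f t)).
  move: (f0 t) At; case: (f t) => c r /= /cA {}cA /cA[U [_ Ux UA]].
  rewrite (_ : _ @^-1` _ = setT); first exact: openT.
  apply/seteqP; split=> // s _; apply: UA.
  by rewrite (surjective_pairing (f s)); exact: sector_le0.
rewrite (_ : _ @^-1` _ = set0); first exact: open0.
by apply/seteqP; split=> // s As; apply: nA; exists s.
Qed.

(** Each point slides back along its arc to the wedge point inside the sector; there one may pass
    from one arc to the other. *)
Lemma sector_path_connected (U : set X) : U x -> path_connected R (sector U).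
Proof.
move=> Ux [c t] [d u] Uct Udu.
have down (b : arc) (r : R) : sector U (b, r) ->
    exists a : {path I from ((b, r) : fan) to (b, Num.min r 0)},
      range a `<=` sector U.
  move=> Ubr; pose f (s : I) : fan := (b, r + itv_val s *: (Num.min r 0 - r)).
  have cf : continuous f.
    apply: (@comp_continuous _ _ _
      (fun s : I => r + itv_val s *: (Num.min r 0 - r))
      (fun t : R => (b, t) : fan)).
      exact: (@segment_continuous R R^o).
    exact: arc_inclusion_continuous.
  have f0 : f zero = (b, r) by rewrite /f itv_val0 scale0r addr0.
  have f1 : f one = (b, Num.min r 0) by rewrite /f itv_val1 scale1r addrC subrK.
  exists (mk_path cf f0 f1) => _ [s _ <-] s' /= ss'; apply: Ubr => /=.
  apply: (le_trans ss'); rewrite gerDl mulr_ge0_le0 //.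
    by have /andP[] := itv_val_bound s.
  by rewrite subr_le0 ge_min lexx.
have [a aU] := down _ _ Uct; have [b bU] := down _ _ Udu.
(* This jump between two representatives of the wedge point is continuous because they are
   indistinguishable. *)
pose h (s : I) : fan :=
  if s == zero then (c, Num.min t 0) else (d, Num.min u 0).
have min0 (r : R) : Num.min r 0 <= 0 by rewrite ge_min lexx orbT.
have ch : continuous h.
  by apply: fan_center_continuous => s; rewrite /h; case: ifP => _; exact: min0.
have h0 : h zero = (c, Num.min t 0) by rewrite /h eqxx.
have h1 : h one = (d, Num.min u 0).
  by rewrite /h eq_sym (negbTE (clamp01_neq R)).
exists (concat (concat a (mk_path ch h0 h1)) (Defs.rev_path b)).
apply: concat_range; first apply: concat_range => //.
  move=> _ [s _ <-]; change (sector U (h s)); rewrite /h.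
  by case: ifP => _; exact: sector_le0.
by move=> _ [s _ <-]; apply: bU; exists (clamp (1 - itv_val s)).
Qed.

(** An open set of positive parameters on one arc avoids the wedge point, so the second clause of
    [fan_open] is vacuous for it. *)
Lemma nbhs_arc (c : arc) (t : R) (A : set R) : 0 < t -> nbhs t A ->
  nbhs ((c, t) : fan) [set z : fan | z.1 = c /\ A z.2].
Proof.
move=> t0 tA; rewrite nbhsE /=.
exists [set z : fan | z.1 = c /\ (A° `&` [set s | 0 < s]) z.2].
  split; last by split=> //; split.
  rewrite fan_openE; split=> [d|d s s0 [_ [_ /=]]]; last by rewrite ltNge s0.
  have [->|dc] := pselect (d = c).
    rewrite (_ : [set _ | _] = A° `&` [set s | 0 < s]).
      by apply: openI; [exact: open_interior|exact: open_gt].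
    by apply/seteqP; split=> s //= [].
  rewrite (_ : [set _ | _] = set0); first exact: open0.
  by apply/seteqP; split=> s //= [].
by move=> z [zc [/interior_subset ? _]].
Qed.

(** Sectors serve at the wedge point, and open intervals of a single arc elsewhere. *)
Lemma fan_locally_path_connected : locally_path_connected R fan.
Proof.
move=> [c t] W; rewrite nbhsE => -[O [oO Oct] OW].
have [t0|t0] := leP t 0.
  have [_ /(_ c t t0 Oct)[U [oU Ux UO]]] := oO.
  exists (sector U); split.
  - exact: sector_open.
  - exact: sector_le0.
  - exact: subset_trans OW.
  - exact: sector_path_connected.
have : nbhs t ([set s | O (c, s)] `&` [set s | 0 < s]).
  apply: filterI; last exact: lt_nbhsr.
  by apply: open_nbhs_nbhs; split=> //; case: oO.
move=> /nbhs_ballP[r r0 rO].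
exists [set z : fan | z.1 = c /\ ball t r z.2]; split.
- rewrite fan_openE; split=> [d|d s s0 [_ /rO[_ /=]]]; last by rewrite ltNge s0.
  have [->|dc] := pselect (d = c).
    rewrite (_ : [set _ | _] = ball t r); first exact: ball_open.
    by apply/seteqP; split=> s //= [].
  rewrite (_ : [set _ | _] = set0); first exact: open0.
  by apply/seteqP; split=> s //= [].
- by split=> //; exact: ballxx.
- by move=> [d s] [/= -> /rO[? _]]; exact: OW.
- move=> [d s] [d' s'] [/= -> ts] [/= -> ts'].
  have [a at_] := @ball_path_connected R R^o t r s s' ts ts'.
  exists (Defs.map_path (@arc_inclusion_continuous c) erefl erefl a).
  by move=> _ [u _ <-]; split=> //; apply: at_; exists u.
Qed.

Lemma fan_path_connected : path_connected R [set: fan].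
Proof.
move=> z w _ _; have [//|||a _] := @sector_path_connected setT _ z w => //.
by exists a.
Qed.

(** The contraction of the fan that scales arc parameters, composed with [fan_eval]. *)
Definition fan_shrink (zs : fan * I) : X :=
  fan_eval (zs.1.1, itv_val zs.2 * zs.1.2).

(** At the wedge point, a sector times the whole interval works, since scaling a positive parameter
    moves back along the arc. Elsewhere, nearby points lie on the same arc and [c] is continuous. *)
Lemma fan_shrink_continuous : continuous fan_shrink.
Proof.
move=> [[c t] s] V; have [t0|t0] := leP t 0.
  have /andP[s0 s1] := itv_val_bound s.
  rewrite {1}/fan_shrink fan_eval_le0 /=; last by rewrite mulr_ge0_le0.
  rewrite {1}nbhsE => -[U [oU Ux] UV].
  exists (sector U, setT) => /=.
    split; last exact: filterT.
    by apply: open_nbhs_nbhs; split; [exact: sector_open|exact: sector_le0].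
  move=> [[d u] s'] [/= Udu _]; apply: UV.
  have /andP[s'0 s'1] := itv_val_bound s'.
  have [u0|u0] := leP u 0.
    by rewrite /fan_shrink fan_eval_le0 //= mulr_ge0_le0.
  by apply: Udu => /=; rewrite ler_piMl // ltW.
move=> cV.
have ck : continuous (fun ts : R * I => sval c (itv_val ts.2 * ts.1)).
  apply: (@comp_continuous _ R _ (fun ts : R * I => itv_val ts.2 * ts.1));
    last exact: arc_continuous.
  apply: (@comp_continuous _ (R * R)%type R
    (fun ts : R * I => (ts.1, itv_val ts.2)) (fun zr => zr.2 * zr.1)).
    apply: pair_continuous; first by move=> ?; exact: cvg_fst.
    exact: itv_val_snd_continuous.
  by move=> zr; apply: cvgM; [exact: cvg_snd|exact: cvg_fst].
have [[A B] /= [tA sB] AB] := ck (t, s) V cV.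
exists ([set z : fan | z.1 = c /\ A z.2], B).
  by split=> //; exact: nbhs_arc.
by move=> [[d u] s'] [/= [-> Au] Bs']; exact: (AB (u, s')).
Qed.

End Fan.

(** * Control of endpoints of lifts of small paths *)

Section SmallLifts.
Variables (R : realType) (E X : topologicalType) (p : E -> X).
Hypothesis cp : continuous p.
Hypothesis lift_p : lpc0_covering R cp.
Local Notation I := (unit_itv R).

(** The lift [l] of [fan_eval] pulls an open part of [V] back to an open set around the wedge point,
    hence containing a sector over some [U]. A path in [U] is an arc whose point at parameter 1 lies
    in this sector, and [l] along this arc is the lift of the path. *)
Lemma lift_small (e : E) (V : set E) : nbhs e V ->
  exists U : set X, [/\ open U, U (p e) &
    forall (x : X) (f : {path I from p e to x}), range f `<=` U ->
      forall (e' : E) (g : {path I from e to e'}), p \o g = f -> V e'].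
Proof.
rewrite nbhsE => -[V' [oV' V'e] V'V].
have cst_arc : continuous (cst (p e) : R -> X) /\
    forall t, t <= 0 -> (cst (p e) : R -> X) t = p e.
  by split=> //; exact: cst_continuous.
pose c0 : arc R (p e) := exist _ _ cst_arc.
have [||||||l [[cl l0 pl] _]] := @lift_nullhomotopic R E X p cp lift_p
  (fan R (p e)) (@fan_shrink R X (p e)) (@fan_eval R X (p e)) e (c0, 0).
- exact: fan_path_connected.
- exact: fan_locally_path_connected.
- exact: fan_shrink_continuous.
- by move=> [c t]; rewrite /fan_shrink [_.2]/= itv_val1 mul1r.
- by move=> [c t]; rewrite /fan_shrink [_.2]/= itv_val0 mul0r fan_eval_le0.
- by move=> t; rewrite /fan_shrink fan_eval_le0 //= mulr0.
have /continuousP/(_ _ oV') := cl.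
rewrite fan_openE => -[_ /(_ c0 0 (lexx _))].
rewrite /preimage /= l0 => /(_ V'e)[U [oU Ue UV]].
exists U; split=> // x f fU e' g pg.
have cf : continuous (f \o @clamp R) /\
    forall t, t <= 0 -> (f \o @clamp R) t = p e.
  split; first exact: clamp_path_continuous.
  by move=> t t0; rewrite /= clamp_le0 // clamp0E path_zero.
pose c : arc R (p e) := exist _ _ cf.
pose h (s : I) : fan R (p e) := if s == zero then (c0, 0) else (c, 0).
(* As [E] need not be separated, continuity of [l] alone does not equate its values at [(c, 0)] and
   [(c0, 0)]. Composed with the jump [h], however, [l] lifts a constant path and is therefore
   constant. *)
have lc0 : l (c, 0) = e.
  have ch : continuous h.
    by apply: fan_center_continuous => s; rewrite /h; case: ifP.
  have : l \o h = cst e.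
    apply: (lift_path_unique lift_p).
    - exact: comp_continuous.
    - exact: cst_continuous.
    - by rewrite /= /h eqxx.
    - apply/funext => s /=; rewrite -[LHS]/((p \o l) (h s)) pl /h.
      by case: ifP => _; rewrite fan_eval_le0.
  by move/(congr1 (@^~ one)); rewrite /= /h eq_sym (negbTE (clamp01_neq R)).
have lg : (fun s : I => l (c, itv_val s)) = g.
  apply: (lift_path_unique lift_p).
  - apply: (@comp_continuous _ _ _
      (fun s : I => (c, itv_val s) : fan R (p e))) => //.
    apply: comp_continuous; first exact: itv_val_continuous.
    exact: arc_inclusion_continuous.
  - exact: cts_fun.
  - by rewrite itv_val0 lc0 path_zero.
  - rewrite pg; apply/funext => s /=.
    rewrite -[LHS]/((p \o l) (c, itv_val s)) pl.
    by rewrite /fan_eval /= itv_valK.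
have <- : l (c, itv_val (one : I)) = e' by rewrite -(path_one (s := g)) -lg.
by apply/V'V/UV => s _; apply: fU; exists (clamp s).
Qed.

End SmallLifts.

(** * Classes of paths and the whisker topology *)

Section Whisker.
Variables (R : realType) (X : topologicalType) (x0 : X).
Variable H : groupClosed (pi1 R x0).
Local Notation I := (unit_itv R).

Lemma whisker_classW (P : whisker_space H -> Prop) :
  (forall y (a : {path I from x0 to y}), P (whisker_class H a)) ->
  forall z, P z.
Proof. by move=> h z; rewrite -[z]reprK; case: (repr z). Qed.

Lemma whisker_class_homotopic (y : X) (a b : {path I from x0 to y}) :
  homotopic a b -> whisker_class H a = whisker_class H b.
Proof.
move=> ab; apply/whisker_classP.
suff /loop_classP -> : homotopic (concat a (Defs.rev_path b)) (cst_path R x0).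
  exact: (@gpred1 _ H : pi1_one R x0 \in H).
apply: homotopic_trans (homotopic_concatV b).
exact: (homotopic_concat ab (homotopic_refl _)).
Qed.

(** This is an equality and not just a homotopy: the two parametrizations coincide. *)
Lemma rev_path_concat (x y z : X) (a : {path I from x to y})
    (b : {path I from y to z}) :
  Defs.rev_path (concat a b) = concat (Defs.rev_path b) (Defs.rev_path a).
Proof.
apply/path_eqP => s; have /andP[s0 s1] := itv_val_bound s.
rewrite rev_pathE; have [h|h] := leP (itv_val s) 2^-1.
  rewrite [RHS]concatE_le // concatE_ge; last by rewrite clampK; lra.
  rewrite rev_pathE clampK; last by lra.
  by rewrite clampK; [congr (b (clamp _)); lra|lra].
rewrite [RHS](concatE_ge _ _ (ltW h)) concatE_le; last by rewrite clampK; lra.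
rewrite rev_pathE clampK; last by lra.
by rewrite clampK; [congr (a (clamp _)); lra|lra].
Qed.

(** In the comparison loop, [c] meets its own reverse and cancels. *)
Lemma whisker_class_concat (y z : X) (a b : {path I from x0 to y})
    (c : {path I from y to z}) :
  whisker_class H a = whisker_class H b ->
  whisker_class H (concat a c) = whisker_class H (concat b c).
Proof.
move=> /whisker_classP abH; apply/whisker_classP.
suff /loop_classP -> : homotopic
    (concat (concat a c) (Defs.rev_path (concat b c)))
    (concat a (Defs.rev_path b)) by [].
rewrite rev_path_concat.
apply: (homotopic_trans (homotopic_sym (homotopic_concatA _ _ _))).
apply: homotopic_concat; first exact: homotopic_refl.
apply: (homotopic_trans (homotopic_concatA _ _ _)).
apply: homotopic_trans (homotopic_concat1 _).
by apply: homotopic_concat; [exact: homotopic_concatV|exact: homotopic_refl].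
Qed.

Lemma whisker_nbhd_open (y : X) (a : {path I from x0 to y}) (U : set X) :
  open U -> U y -> open (whisker_nbhd H a U).
Proof.
move=> oU Uy; exists [set whisker_nbhd H a U]; last by rewrite bigcup_set1.
move=> _ ->; exists [fset whisker_nbhd H a U]%fset.
  by move=> B; rewrite in_fset1 => /eqP ->; rewrite inE; exists y, a, U.
by rewrite set_fset1 bigcap_set1.
Qed.

(** Continuity at a point may be tested on the generating sets, because neighborhoods contain finite
    intersections of them. *)
Lemma whisker_continuous (T : topologicalType) (f : T -> whisker_space H)
    (t : T) :
  (forall y (a : {path I from x0 to y}) U, open U -> U y ->
    whisker_nbhd H a U (f t) -> nbhs t (f @^-1` whisker_nbhd H a U)) ->
  {for t, continuous f}.
Proof.
move=> ft A; rewrite {1}nbhsE => -[_ [[D sD <-] [C DC Ct]] sUA].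
apply: (@filterS _ _ _ (f @^-1` C)); first by move=> s Cs; apply: sUA; exists C.
have [F sF FC] := sD _ DC; rewrite -FC preimage_bigcap.
apply: filter_bigI => B BF.
have /sF := BF; rewrite inE => -[y [a [U [oU Uy BE]]]].
rewrite BE; apply: ft => //; rewrite -BE.
by move: Ct; rewrite -FC; exact.
Qed.

End Whisker.

(** * The comparison map to the whisker space *)

Section WhiskerMap.
Variables (R : realType) (E X : topologicalType) (p : E -> X) (e0 : E).
Hypothesis cp : continuous p.
Hypothesis lift_p : lpc0_covering R cp.
Variable H : groupClosed (pi1 R (p e0)).
Hypothesis Hp : range (pi1_map R cp (erefl (p e0))) = [set` H].
Local Notation I := (unit_itv R).

Lemma map_path_concat (x y z : E) (x' y' z' : X) (px : p x = x') (py : p y = y')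
    (pz : p z = z') (a : {path I from x to y}) (b : {path I from y to z}) :
  Defs.map_path cp px pz (concat a b) =
  concat (Defs.map_path cp px py a) (Defs.map_path cp py pz b).
Proof.
apply/path_eqP => s.
rewrite [RHS]concatE /concat_fun /= /mk_path /= /concat_fun.
by case: ifP.
Qed.

Lemma path_to_exists (e : E) : exists _ : {path I from e0 to e}, True.
Proof. by have [/(_ e0 e Logic.I Logic.I)[a _] _ _] := lift_p; exists a. Qed.

Definition path_to (e : E) : {path I from e0 to e} :=
  projT1 (cid (path_to_exists e)).

Definition whisker_map (e : E) : whisker_space H :=
  whisker_class H (Defs.map_path cp erefl erefl (path_to e)).

(** The value does not depend on the choice made in [path_to]: two paths from [e0] to [e] form a
    loop in [E], whose image has its class in [H]. *)
Lemma whisker_mapE (e : E) (x : X) (px : p e = x) (g : {path I from e0 to e}) :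
  whisker_map e = whisker_class H (Defs.map_path cp erefl px g).
Proof.
case: x / px; apply/whisker_classP.
suff : [set` H] (pi1_map R cp (erefl (p e0))
    (loop_class (concat (path_to e) (Defs.rev_path g)))).
  rewrite pi1_mapE (map_path_concat _ erefl).
  suff -> : Defs.map_path cp erefl erefl (Defs.rev_path g) =
      Defs.rev_path (Defs.map_path cp erefl erefl g) by [].
  exact/path_eqP.
by rewrite -Hp; eexists.
Qed.

(** By [Hp], the loop comparing [a] with [b] is homotopic to the image of a loop [l] at [e0]. So [a]
    is homotopic to the image of [concat l h], which ends where [h] does, and [monodromy]
    concludes. *)
Lemma whisker_class_lift (x : X) (a b : {path I from p e0 to x}) (e1 e2 : E)
    (g : {path I from e0 to e1}) (h : {path I from e0 to e2}) :
  whisker_class H a = whisker_class H b -> p \o g = a -> p \o h = b -> e1 = e2.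
Proof.
move=> /whisker_classP abH pg ph.
have : [set` H] (loop_class (concat a (Defs.rev_path b))) by [].
rewrite -Hp => -[q _]; elim/loop_classW: q => l.
rewrite pi1_mapE => /loop_classP lab.
have pe2 : p e2 = x by rewrite -(path_one (s := b)) -ph /= path_one.
apply: (monodromy lift_p _ pg (h := concat l h)
  (b := Defs.map_path cp erefl pe2 (concat l h))) => //.
have bE : b = Defs.map_path cp erefl pe2 h.
  by apply/path_eqP => s; rewrite -ph.
rewrite (map_path_concat _ erefl) -bE; apply: homotopic_sym.
apply: (homotopic_trans (homotopic_concat lab (homotopic_refl _))).
apply: (homotopic_trans (homotopic_sym (homotopic_concatA _ _ _))).
apply: homotopic_trans (homotopic_concatr1 _).
by apply: homotopic_concat; [exact: homotopic_refl|exact: homotopic_Vconcat].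
Qed.

Lemma whisker_map_proj (e : E) : whisker_proj H (whisker_map e) = p e.
Proof. exact: whisker_projE. Qed.

Lemma whisker_map_inj : injective whisker_map.
Proof.
move=> e1 e2 e12.
have p12 : p e1 = p e2.
  by rewrite -[LHS]whisker_map_proj e12 whisker_map_proj.
move: e12; rewrite (whisker_mapE p12 (path_to e1)) => e12.
exact: (whisker_class_lift e12).
Qed.

Lemma whisker_map_surj (z : whisker_space H) : exists e, whisker_map e = z.
Proof.
elim/whisker_classW: z => y a.
have [e [g [pe pg]]] := lift_path lift_p a.
exists e; rewrite (whisker_mapE pe g); congr whisker_class.
by apply/path_eqP => s; rewrite -pg.
Qed.

Lemma whisker_map_continuous : continuous whisker_map.
Proof.
move=> e; apply: whisker_continuous => y a U oU Uy [y' [b [bU eb]]].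
have py' : p e = y' by rewrite -[LHS]whisker_map_proj eb whisker_projE.
case: y' / py' in b bU eb *.
have Ue : U (p e) by apply: bU; exists one => //; rewrite path_one.
have pU : nbhs e (p @^-1` U) by apply: cp; exact: open_nbhs_nbhs.
(* Points of [V] are joined to [e] inside [V]; the image of such a path stays in [U] and prolongs
   the whisker [b]. *)
have [_ /(_ e _ pU)[V [oV Ve VU Vc]] _] := lift_p.
rewrite nbhsE; exists V; first by split.
move=> e' Ve'.
have [d dV] := Vc e e' Ve Ve'.
exists (p e'), (concat b (Defs.map_path cp erefl erefl d)); split.
  apply: concat_range => //; apply: (@map_path_range R).
  exact: subset_trans VU.
rewrite (whisker_class_homotopic H (homotopic_concatA _ _ _)).
rewrite -(whisker_class_concat _ eb) -map_path_concat.
exact: whisker_mapE.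
Qed.

Lemma whisker_map_homeomorphism : homeomorphism whisker_map.
Proof.
split; first exact: whisker_map_continuous.
pose g z := projT1 (cid (whisker_map_surj z)).
have gK : cancel g whisker_map by move=> z; rewrite /g; case: cid.
have Kg : cancel whisker_map g by exact: (inj_can_sym gK whisker_map_inj).
exists g; split=> // z V Vgz.
(* Continuity of the inverse: a class in the whisker neighborhood of [z] over [U] extends [a] by a
   path [b] in [U]. The lift of [b] at [g z] ends in [V], at the preimage of that class. *)
have [U [oU Ue UV]] := lift_small lift_p Vgz.
pose a : {path I from p e0 to p (g z)} :=
  Defs.map_path cp erefl erefl (path_to (g z)).
have za : whisker_class H a = z by exact: gK.
have Wz : whisker_nbhd H a U z.
  exists (p (g z)), (cst_path R (p (g z))); split; first by move=> _ [t _ <-].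
  rewrite -{1}za; apply/whisker_class_homotopic/homotopic_sym.
  exact: homotopic_concatr1.
rewrite /= nbhsE; exists (whisker_nbhd H a U).
  by split=> //; exact: whisker_nbhd_open.
move=> w [y [b [bU ->]]] /=.
have [e' [d [pe' pd]]] := lift_path lift_p b.
rewrite (_ : whisker_class _ _ = whisker_map e').
  by rewrite /preimage /= Kg; exact: (UV _ _ bU _ _ pd).
rewrite (whisker_mapE pe' (concat (path_to (g z)) d)) (map_path_concat _ erefl).
congr (whisker_class H (concat _ _)).
by apply/path_eqP => s; rewrite -pd.
Qed.

Lemma whisker_map_base : whisker_map e0 = whisker_base H.
Proof.
rewrite (whisker_mapE erefl (cst_path R e0)); congr whisker_class.
exact/path_eqP.
Qed.

End WhiskerMap.

Theorem lemma56 (R : realType) (X E : topologicalType) (x0 : X) (e0 : E)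
    (p : E -> X) (cp : continuous p) (pe0 : p e0 = x0)
    (H : groupClosed (pi1 R x0)) :
  path_connected R [set: X] ->
  lpc0_covering R cp ->
  range (pi1_map R cp pe0) = [set` H] ->
  exists pt : E -> whisker_space H,
    [/\ homeomorphism pt, pt e0 = whisker_base H &
        whisker_proj H \o pt = p].
Proof.
case: x0 / pe0 in H * => _ lift_p Hp.
exists (whisker_map lift_p H); split.
- exact: whisker_map_homeomorphism.
- exact: whisker_map_base.
- by apply/funext => e; exact: whisker_map_proj.
Qed.
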